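(* Let $a\in\mathcal{A}$ and let $m\geq 1$ be an integer. The following are equivalent: (1) $a$ has an $m$-generalized right group inverse. (2) There exists $b\in\mathcal{A}$ such that $bab=b$, $a^2b^2=ab$, $[(a^m)^*a^{m+1}b]^*=(a^m)^*a^{m+1}b$, $ab\mathcal{A}=a^2b\mathcal{A}$, and $a-a^2b\in\mathcal{A}^{qnil}$.
   Context: $\mathcal{A}$ is a unital complex Banach *-algebra, i.e. a Banach algebra with an involution $*$ satisfying $(x+y)^*=x^*+y^*$, $(\lambda x)^*=\overline{\lambda}x^*$, $(xy)^*=y^*x^*$, $(x^* )^*=x$; the involution is assumed proper: $x^*x=0$ implies $x=0$. $\mathcal{A}^{qnil}=\{x\in\mathcal{A}: \lim_{n\to\infty}\|x^n\|^{1/n}=0\}$. An element $d\in\mathcal{A}$ is a generalized right Drazin inverse of $a$ if $ad^2=d$, $a^2d=ada$ and $a-ada\in\mathcal{A}^{qnil}$ (it need not be unique). An element $x\in\mathcal{A}$ is an $m$-generalized right group inverse of $a$ if there is a generalized right Drazin inverse $d$ of $a$ such that $x=ax^2$, $(ad)^*a^{m+1}x=(ad)^*a^m$ and $\lim_{n\to\infty}\|a^n-axa^n\|^{1/n}=0$. *)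

(* Defs.v *)
From HB Require Import structures.
From mathcomp Require Import all_boot all_order all_algebra.
From mathcomp Require Import complex.
From mathcomp Require Import all_classical all_reals all_analysis.

Set Implicit Arguments.
Unset Strict Implicit.
Unset Printing Implicit Defensive.

Import Order.TTheory GRing.Theory Num.Theory.
Import numFieldNormedType.Exports.

Local Open Scope classical_set_scope.
Local Open Scope ring_scope.

(* The product is declared on top of the normed space, rather than as a join of
   the two library hierarchies: such a join is rejected by Hierarchy Builder,
   since numDomainType already joins normed groups and rings. The norm is only
   required to be submultiplicative; `|1| = 1 is not imposed. *)
Record banachAlgType (R : realType) := BanachAlgType {
  banach_space : completeNormedModType R[i] ;
  banach_mul : banach_space -> banach_space -> banach_space ;
  banach_one : banach_space ;
  banach_mulA : associative banach_mul ;
  banach_mul1l : left_id banach_one banach_mul ;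
  banach_mul1r : right_id banach_one banach_mul ;
  banach_mulDl : left_distributive banach_mul +%R ;
  banach_mulDr : right_distributive banach_mul +%R ;
  banach_oner_neq0 : banach_one != 0 ;
  banach_scaleAl : forall (c : R[i]) (x y : banach_space),
    c *: banach_mul x y = banach_mul (c *: x) y ;
  banach_scaleAr : forall (c : R[i]) (x y : banach_space),
    c *: banach_mul x y = banach_mul x (c *: y) ;
  banach_normM : forall x y : banach_space,
    `|banach_mul x y| <= `|x| * `|y|
}.

Definition banach_sort (R : realType) (A : banachAlgType R) : Type :=
  banach_space A.
Coercion banach_sort : banachAlgType >-> Sortclass.

HB.instance Definition _ (R : realType) (A : banachAlgType R) :=
  CompleteNormedModule.copy (banach_sort A) (banach_space A).

HB.instance Definition _ (R : realType) (A : banachAlgType R) :=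
  GRing.Zmodule_isNzRing.Build (banach_sort A) (@banach_mulA R A)
    (@banach_mul1l R A) (@banach_mul1r R A) (@banach_mulDl R A)
    (@banach_mulDr R A) (@banach_oner_neq0 R A).

HB.instance Definition _ (R : realType) (A : banachAlgType R) :=
  GRing.Lmodule_isLalgebra.Build R[i] (banach_sort A) (@banach_scaleAl R A).

HB.instance Definition _ (R : realType) (A : banachAlgType R) :=
  GRing.Lalgebra_isAlgebra.Build R[i] (banach_sort A) (@banach_scaleAr R A).

(* No continuity of the involution is assumed. *)
Record banachStarAlgType (R : realType) := BanachStarAlgType {
  star_base :> banachAlgType R ;
  star : star_base -> star_base ;
  starD : forall x y, star (x + y) = star x + star y ;
  starZ : forall (c : R[i]) x, star (c *: x) = conjc c *: star x ;
  starM : forall x y, star (x * y) = star y * star x ;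
  starK : forall x, star (star x) = x
}.

Definition proper_involution (R : realType) (A : banachStarAlgType R) : Prop :=
  forall x : A, star x * x = 0 -> x = 0.

(* On a space over R[i] the library norm takes values in R[i]; its real
   part is the usual real-valued norm. *)
Definition rnorm (R : realType) (A : banachAlgType R) (x : A) : R :=
  complex.Re `|x|.

(* lim_n ||u n||^(1/n) = 0; the junk term n = 0 does not affect the limit. *)
Definition root_norm_cvg0 (R : realType) (A : banachAlgType R)
    (u : nat -> A) : Prop :=
  (rnorm (u n) `^ (n%:R)^-1) @[n --> \oo] --> (0 : R).

Definition qnil (R : realType) (A : banachAlgType R) : set A :=
  [set x : A | root_norm_cvg0 (fun n => x ^+ n)].

Definition gen_right_drazin_inverse (R : realType) (A : banachAlgType R)
    (a d : A) : Prop :=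
  [/\ a * d ^+ 2 = d, a ^+ 2 * d = a * d * a & qnil (a - a * d * a)].

Definition gen_right_group_inverse (R : realType) (A : banachStarAlgType R)
    (m : nat) (a x : A) : Prop :=
  exists d : A,
    [/\ gen_right_drazin_inverse a d,
        x = a * x ^+ 2,
        star (a * d) * a ^+ m.+1 * x = star (a * d) * a ^+ m &
        root_norm_cvg0 (fun n => a ^+ n - a * x * a ^+ n)].

Definition principal_right_ideal (A : nzRingType) (x : A) : set A :=
  [set x * y | y in [set: A]].

(* Main.v *)
(** An [m]-generalized right group inverse [x] and an outer inverse [b] as in (2)
are linked by the idempotent [q = a x = a b], which satisfies [q a q = a q].

From [x] one takes [b = x a x].  With [p = a d], which commutes with [a], the
quasinilpotency hypotheses force [q p = p] and [p q = q]: each defect [y]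
factors as [y = u_n v^n] for all [n >= 1] with [||u_n||^(1/n) -> 0], so [y = 0].

From [b] one takes [x = c := q b q].  Relative to [q], [a] is block upper
triangular with a right invertible corner and a quasinilpotent one, the latter
carried by [N = a - a q].  The idempotent with the same range as [q] commuting
with [a] is [p = q + s], where [s] solves the Sylvester equation
[a s - s N = q N]; since [N] is quasinilpotent, [s] is the norm-convergent
series of the [c^(k+1) N^(k+1)].  Then [d = c p] is the required generalized
right Drazin inverse. *)
Require Import Defs.
From mathcomp Require Import all_boot all_order all_algebra.
From mathcomp Require Import complex.
From mathcomp Require Import all_classical all_reals all_analysis.
From mathcomp Require Import ring.

Set Implicit Arguments.
Unset Strict Implicit.
Unset Printing Implicit Defensive.

Import Order.TTheory GRing.Theory Num.Theory.
Import numFieldNormedType.Exports.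

Local Open Scope ring_scope.

(** * Real-valued norm and sequences with vanishing root norm *)

Section RealNorm.
Local Open Scope classical_set_scope.
Local Open Scope complex_scope.
Variables (R : realType) (A : banachAlgType R).
Implicit Types (x y : A) (u : nat -> A).

Lemma normr_rnorm x : `|x| = (rnorm x)%:C.
Proof. by rewrite /rnorm RRe_real. Qed.

Lemma rnorm_ge0 x : 0 <= rnorm x.
Proof. by rewrite -lecR -normr_rnorm normr_ge0. Qed.

Lemma rnormM x y : rnorm (x * y) <= rnorm x * rnorm y.
Proof. by rewrite -lecR rmorphM /= -!normr_rnorm; exact: banach_normM. Qed.

Lemma rnorm_eq0 x : rnorm x = 0 -> x = 0.
Proof. by move=> x0; apply/eqP; rewrite -normr_eq0 normr_rnorm x0. Qed.

Lemma rnormX x n : rnorm (x ^+ n) <= rnorm (1 : A) * rnorm x ^+ n.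
Proof.
elim: n => [|n IHn]; first by rewrite !expr0 mulr1.
rewrite !exprSr mulrA (le_trans (rnormM _ _))//.
by rewrite ler_wpM2r// rnorm_ge0.
Qed.

Lemma cvgMrl (F : set_system nat) {FF : Filter F} u x y :
  u @ F --> y -> (x * u n) @[n --> F] --> x * y.
Proof.
move=> /cvgrPdist_lt uy; apply/cvgrPdist_lt => e e0.
have x1 : 0 < `|x| + 1 by rewrite ltr_wpDl.
have := uy _ (divr_gt0 e0 x1); apply: filterS => n; rewrite ltr_pdivlMr// => h.
rewrite -mulrBr (le_lt_trans (banach_normM _ _))// (le_lt_trans _ h)//.
by rewrite mulrC ler_wpM2l// lerDl.
Qed.

Lemma cvgMrr (F : set_system nat) {FF : Filter F} u x y :
  u @ F --> y -> (u n * x) @[n --> F] --> y * x.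
Proof.
move=> /cvgrPdist_lt uy; apply/cvgrPdist_lt => e e0.
have x1 : 0 < `|x| + 1 by rewrite ltr_wpDl.
have := uy _ (divr_gt0 e0 x1); apply: filterS => n; rewrite ltr_pdivlMr// => h.
rewrite -mulrBl (le_lt_trans (banach_normM _ _))// (le_lt_trans _ h)//.
by rewrite ler_wpM2l// lerDl.
Qed.

(** A root-free form of [root_norm_cvg0]: domination by every geometric rate is stable under
    products and index shifts, and summable by comparison. *)
Definition superexp_small u :=
  forall e : R, 0 < e -> exists C : R, forall n, rnorm (u n) <= C * e ^+ n.

Lemma root_norm_cvg0P u : root_norm_cvg0 u <-> superexp_small u.
Proof.
split=> [u0 e e0|us].
  have /cvgrPdist_le/(_ _ e0)[N _ uN] := u0.
  (* [S] pays for the finitely many indices before the root drops below [e]; the added 1 serves all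
     later ones. *)
  pose S := \sum_(k < N.+1) rnorm (u k) / e ^+ k.
  have S0 : 0 <= S.
    by apply: sumr_ge0 => k _; rewrite divr_ge0 ?rnorm_ge0 ?exprn_ge0 ?ltW.
  exists (1 + S) => n; have [nN|Nn] := ltnP n N.+1.
    rewrite -ler_pdivrMr ?exprn_gt0//.
    rewrite /S (bigD1 (Ordinal nN))//= addrCA lerDl addr_ge0//.
    by apply: sumr_ge0 => k _; rewrite divr_ge0 ?rnorm_ge0 ?exprn_ge0 ?ltW.
  have := uN n (ltnW Nn).
  rewrite /= distrC subr0 ger0_norm ?powR_ge0// => une.
  have n0 : n%:R != 0 :> R by rewrite pnatr_eq0 -lt0n (leq_ltn_trans _ Nn).
  have -> : rnorm (u n) = (rnorm (u n) `^ n%:R^-1) ^+ n.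
    by rewrite -powR_mulrn ?powR_ge0// -powRrM mulVf// powRr1// rnorm_ge0.
  apply: (@le_trans _ _ (e ^+ n)).
    by rewrite lerXn2r ?nnegrE ?powR_ge0 ?(ltW e0).
  by rewrite ler_peMl ?exprn_ge0 ?(ltW e0)// lerDl.
apply/cvgrPdist_le => e e0.
(* The spare factor [2^-n] eventually absorbs [C]. *)
have [C uC] := us (e / 2) ltac:(by rewrite divr_gt0).
have half : `|2^-1| < 1 :> R by rewrite ger0_norm ?invf_lt1 ?ltr1n.
have /cvgrPdist_le/(_ _ ltr01)[N _ CN] := cvg_geometric C half.
exists N.+1 => // n Nn /=.
rewrite distrC subr0 ger0_norm ?powR_ge0//.
have n0 : n%:R != 0 :> R by rewrite pnatr_eq0 -lt0n (leq_ltn_trans _ Nn).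
have -> : e = (e ^+ n) `^ n%:R^-1.
  by rewrite -powR_mulrn ?ltW// -powRrM mulfV// powRr1// ltW.
apply: ge0_ler_powR;
  rewrite ?invr_ge0 ?nnegrE ?rnorm_ge0 ?exprn_ge0 ?(ltW e0)//.
apply: (le_trans (uC n)); rewrite exprMn mulrCA ler_piMr ?exprn_ge0 ?(ltW e0)//.
apply: le_trans (CN n (ltnW Nn)).
by rewrite /geometric /= distrC subr0 ler_norm.
Qed.

Lemma superexp_smallMlr u x y :
  superexp_small u -> superexp_small (fun n => x * u n * y).
Proof.
move=> us e /us[C uC]; exists (rnorm x * C * rnorm y) => n.
rewrite (le_trans (rnormM _ _))// mulrAC ler_wpM2r ?rnorm_ge0//.
by rewrite (le_trans (rnormM _ _))// -mulrA ler_wpM2l ?rnorm_ge0.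
Qed.

Lemma superexp_smallS u :
  superexp_small (fun n => u n.+1) <-> superexp_small u.
Proof.
split=> us e e0; have [C uC] := us e e0.
  (* The first summand makes up for the shift by one power of [e], the second covers index 0. *)
  exists (C / e + rnorm (u 0%N)) => -[|n].
    rewrite expr0 mulr1 lerDr divr_ge0 ?(ltW e0)//.
    by have := uC 0%N; rewrite expr0 mulr1; exact: le_trans (rnorm_ge0 _).
  rewrite mulrDl exprS mulrA divfK ?gt_eqF// (le_trans (uC n))// lerDl.
  by rewrite mulr_ge0 ?rnorm_ge0// -exprS exprn_ge0 ?(ltW e0).
by exists (C * e) => n; rewrite -mulrA -exprS.
Qed.

Lemma superexp_smallM u x :
  superexp_small u -> superexp_small (fun n => u n * x ^+ n).
Proof.
(* Rate [e / (rnorm x + 1)] for [u] outweighs the at most geometric growth of [x ^+ n]; adding 1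
   keeps the divisor positive. *)
move=> us e e0; have x0 : 0 < rnorm x + 1 by rewrite ltr_wpDl ?rnorm_ge0.
have [C uC] := us _ (divr_gt0 e0 x0); exists (C * rnorm (1 : A)) => n.
rewrite (le_trans (rnormM _ _))//.
apply: (@le_trans _ _ ((C * (e / (rnorm x + 1)) ^+ n) *
                       (rnorm (1 : A) * (rnorm x + 1) ^+ n))).
  rewrite ler_pM ?rnorm_ge0// (le_trans (rnormX _ _))//.
  rewrite ler_wpM2l ?rnorm_ge0// lerXn2r ?nnegrE ?rnorm_ge0 ?(ltW x0)//.
  by rewrite lerDl.
by rewrite mulrACA -exprMn divfK ?gt_eqF.
Qed.

Lemma superexp_smallMX u x :
  superexp_small u -> superexp_small (fun n => x ^+ n * u n).
Proof.
move=> us e e0; have x0 : 0 < rnorm x + 1 by rewrite ltr_wpDl ?rnorm_ge0.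
have [C uC] := us _ (divr_gt0 e0 x0); exists (rnorm (1 : A) * C) => n.
rewrite (le_trans (rnormM _ _))//.
apply: (@le_trans _ _ ((rnorm (1 : A) * (rnorm x + 1) ^+ n) *
                       (C * (e / (rnorm x + 1)) ^+ n))).
  rewrite ler_pM ?rnorm_ge0// (le_trans (rnormX _ _))//.
  rewrite ler_wpM2l ?rnorm_ge0// lerXn2r ?nnegrE ?rnorm_ge0 ?(ltW x0)//.
  by rewrite lerDl.
by rewrite mulrACA -exprMn mulrC [_ * (e / _)]mulrC divfK ?gt_eqF// mulrC.
Qed.

(** A constant below [C * 2^-n] for all positive [n] is zero. This is the tool that kills the
    defects; index 0 is left free because their factorizations start at exponent 1. *)
Lemma superexp_small_cst x u :
  superexp_small u -> (forall n, u n.+1 = x) -> x = 0.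
Proof.
move=> us ux; apply: rnorm_eq0; apply/eqP; rewrite eq_le rnorm_ge0 andbT.
have [C uC] := us _ [gt0 of 2^-1 : R].
have half : `|2^-1| < 1 :> R by rewrite ger0_norm ?invf_lt1 ?ltr1n.
apply/ler_addgt0Pl => e e0; rewrite addr0.
have /cvgrPdist_le/(_ _ e0)[N _ CN] := cvg_geometric C half.
rewrite -(ux N) (le_trans (uC _))//.
apply: le_trans (CN N.+1 (leqnSn _)).
by rewrite /geometric /= distrC subr0 ler_norm.
Qed.

Lemma superexp_small_cvg_series u :
  superexp_small u -> cvgn (series u).
Proof.
move=> us; apply/cauchy_cvgP/cauchy_seriesP => e e0.
have eE : e = (complex.Re e)%:C by rewrite RRe_real// gtr0_real.
have re0 : 0 < complex.Re e by rewrite -ltcR -eE.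
have [C uC] := us _ [gt0 of 2^-1 : R].
have C0 : 0 <= C.
  by have := uC 0%N; rewrite expr0 mulr1; exact: le_trans (rnorm_ge0 _).
have half : `|2^-1| < 1 :> R by rewrite ger0_norm ?invf_lt1 ?ltr1n.
(* The tail from [m] of the dominating series of [C * 2^-k] is at most [2 * C * 2^-m]. *)
have /cvgrPdist_lt/(_ _ re0)[N _ CN] := cvg_geometric (2 * C) half.
have bound m n : (m <= n)%N ->
    \sum_(m <= k < n) C * 2^-1 ^+ k = 2 * C * 2^-1 ^+ m - 2 * C * 2^-1 ^+ n.
  elim: n => [|n IHn]; first by rewrite leqn0 => /eqP ->; rewrite big_geq ?subrr.
  rewrite leq_eqVlt => /predU1P[->|mn]; first by rewrite big_geq ?subrr.
  by rewrite big_nat_recr//= IHn// exprS; field.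
exists ([set n | (N <= n)%N], [set: nat]); first by split=> //; exists N.
move=> [m n] /= [Nm _].
have [mn|nm] := leqP m n; last by rewrite big_geq ?normr0// ltnW.
rewrite (le_lt_trans (ler_norm_sum _ _ _))//.
under eq_bigr do rewrite normr_rnorm.
rewrite -rmorph_sum/= eE ltcR.
apply: le_lt_trans (CN m Nm); rewrite /geometric/= distrC subr0.
apply: le_trans (ler_norm _).
apply: (@le_trans _ _ (\sum_(m <= k < n) C * 2^-1 ^+ k)).
  by apply: ler_sum => k _; exact: uC.
by rewrite bound// gerBl !mulr_ge0 ?exprn_ge0.
Qed.

End RealNorm.

Arguments cvgMrl {R A F FF u} x {y} _.
Arguments cvgMrr {R A F FF u} x {y} _.

(** * Powers of elements relative to an invariant corner *)

Section RingFacts.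
Variable T : nzRingType.
Implicit Types a q x : T.

Lemma exprSM_right_inverse a x n :
  a * x ^+ 2 = x -> a ^+ n.+1 * x ^+ n.+1 = a * x.
Proof.
move=> ax2; elim: n => [|n IHn]; first by rewrite !expr1.
by rewrite exprSr -mulrA -[n.+2]add2n (exprD x) (mulrA a) ax2 -exprS.
Qed.

Lemma mul_corner_expr a q n : q * q = q -> q * a * q = a * q ->
  q * a ^+ n * q = a ^+ n * q.
Proof.
move=> qq qaq; elim: n => [|n IHn]; first by rewrite mulr1 mul1r.
by rewrite exprSr -!mulrA -[a * q]qaq !mulrA IHn.
Qed.

(** Invariance of the range of [q] gives [(a - a * q) * (a * q) = 0], so in a power every factor but
    the leftmost may be replaced by [a]. *)
Lemma expr_subr_corner a q n : q * a * q = a * q ->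
  (a - a * q) ^+ n.+1 = (a - a * q) * a ^+ n.
Proof.
move=> qaq; have z : (a - a * q) * (a * q) = 0.
  by rewrite mulrBl -[a * q * _]mulrA (mulrA q) qaq subrr.
elim: n => [|n IHn]; first by rewrite mulr1.
by rewrite exprS IHn mulrA mulrBr z subr0 -mulrA -exprS.
Qed.

End RingFacts.

(** * The two implications *)

Section Equivalence.
Local Open Scope classical_set_scope.
Variables (R : realType) (A : banachStarAlgType R).
Implicit Types (a b d x : A) (m : nat).

Lemma gen_right_group_inverse_outer m a x : gen_right_group_inverse m a x ->
  exists b,
    [/\ b * a * b = b,
        a ^+ 2 * b ^+ 2 = a * b,
        star (star (a ^+ m) * a ^+ m.+1 * b) = star (a ^+ m) * a ^+ m.+1 * b,
        principal_right_ideal (a * b) = principal_right_ideal (a ^+ 2 * b) &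
        qnil (a - a ^+ 2 * b)].
Proof.
move=> [d [[ad2 a2d /root_norm_cvg0P N0] /esym ax2 sx /root_norm_cvg0P V0]].
rewrite -a2d in N0.
pose p := a * d; pose q := a * x.
have pa : p * a = a * p by rewrite /p -a2d expr2 mulrA.
have pd : p * d = d by rewrite /p -mulrA -expr2.
have qx : q * x = x by rewrite /q -mulrA -expr2.
have pp : p * p = p by rewrite {2}/p mulrA pa -mulrA pd.
have qq : q * q = q.
  apply/esym/eqP; rewrite -subr_eq0; apply/eqP.
  (* For positive [n], [a ^+ n * x ^+ n = q], so the defect of [a ^+ n] times [x ^+ n] is the
     constant [q - q * q]. *)
  apply: (superexp_small_cst (superexp_smallM x V0)) => n.
  by rewrite mulrBl -[_ * _ * x ^+ _]mulrA exprSM_right_inverse.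
have qp : q * p = p.
  apply/esym/eqP; rewrite -subr_eq0; apply/eqP.
  apply: (superexp_small_cst (superexp_smallM d V0)) => n.
  by rewrite mulrBl -[_ * _ * d ^+ _]mulrA exprSM_right_inverse.
have qd : q * d = d by rewrite -{1}pd mulrA qp.
have pq : p * q = q.
  apply/esym/eqP; rewrite -subr_eq0; apply/eqP.
  (* Here [(a - a * p) ^+ n * x ^+ n] equals [q - p * q] for positive [n]. *)
  apply: (superexp_small_cst (superexp_smallM x N0)) => n.
  rewrite expr2 -mulrA -/p expr_subr_corner; last by rewrite pa -mulrA pp.
  rewrite mulrBl -exprS mulrBl exprSM_right_inverse// -pa -(mulrA p) -exprS.
  by rewrite -mulrA exprSM_right_inverse.
have qaq : q * a * q = a * q.
  have paq : p * (a * q) = a * q by rewrite mulrA pa -mulrA pq.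
  by rewrite -mulrA -paq mulrA qp.
exists (x * q).
have ab : a * (x * q) = q by rewrite mulrA.
have a2b : a ^+ 2 * (x * q) = a * q by rewrite expr2 -mulrA ab.
have amb : a ^+ m.+1 * (x * q) = a ^+ m * q by rewrite exprSr -mulrA ab.
split.
- by rewrite -(mulrA _ a) ab -mulrA qq.
- by rewrite expr2 [(_ * q) ^+ 2]expr2 (mulrA _ _ (_ * q)) -(mulrA a) ab
    -(mulrA a) (mulrA q) qx ab.
- have qB : q * (a ^+ m * q) = a ^+ m * q by rewrite mulrA mul_corner_expr.
  (* The range of [a ^+ m * q] lies in that of [p], so its star ends in [star p], where the
     hypothesis on [x] applies. The right-hand side is self-adjoint, which yields the required
     symmetry. *)
  have sB : star (a ^+ m * q) * a ^+ m = star (a ^+ m * q) * (a ^+ m * q).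
    have -> : star (a ^+ m * q) = star (a ^+ m * q) * star q * star p.
      by rewrite -mulrA -[star q * star p]starM pq -starM qB.
    by rewrite -[LHS]mulrA -[RHS]mulrA /p -sx exprSr -!mulrA.
  rewrite -mulrA amb starM starK sB.
  by have /(congr1 (@star _ A)) := sB; rewrite !starM !starK.
- rewrite ab a2b; apply/seteqP; split=> _ [y _ <-].
    exists (d * q * y) => //.
    by rewrite mulrA -[a * q * _]mulrA (mulrA q) qd (mulrA a) pq.
  by exists (a * q * y) => //; rewrite (mulrA q) (mulrA q) qaq.
- apply/root_norm_cvg0P/superexp_smallS; rewrite a2b.
  have -> : (fun n => (a - a * q) ^+ n.+1) =
            (fun n => a * (a ^+ n - a * x * a ^+ n) * 1).
    by apply/funext => n; rewrite mulr1 expr_subr_corner// mulrBl mulrBr !mulrA.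
  exact: superexp_smallMlr.
Qed.

Lemma outer_gen_right_group_inverse m a b :
  b * a * b = b ->
  a ^+ 2 * b ^+ 2 = a * b ->
  star (star (a ^+ m) * a ^+ m.+1 * b) = star (a ^+ m) * a ^+ m.+1 * b ->
  principal_right_ideal (a * b) = principal_right_ideal (a ^+ 2 * b) ->
  qnil (a - a ^+ 2 * b) ->
  gen_right_group_inverse m a (a * b * b * (a * b)).
Proof.
move=> bab a2b2 sab abA /root_norm_cvg0P N0.
pose q := a * b; pose N := a - a * q; pose c := q * b * q; rewrite -/q -/c.
have a2b : a ^+ 2 * b = a * q by rewrite expr2 -mulrA.
have amb : a ^+ m.+1 * b = a ^+ m * q by rewrite exprSr -mulrA.
rewrite a2b -/N in N0.
have qq : q * q = q by rewrite /q -mulrA (mulrA b) bab.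
have qaq : q * a * q = a * q.
  (* An element of the right ideal generated by the idempotent [q] is fixed by [q] on the left. *)
  have : principal_right_ideal (a * b) (a * q).
    by rewrite abA -a2b; exists 1; rewrite ?mulr1.
  by case=> y _; rewrite -/q => e; rewrite -mulrA -e (mulrA q) qq.
have aqb : a * q * b = q by rewrite /q -[RHS]a2b2 !expr2 !mulrA.
have qB : q = a * b by [].
clearbody q.
have qc : q * c = c by rewrite /c !mulrA qq.
have ac : a * c = q by rewrite /c !(mulrA a) aqb qq.
have ac2 : a * c ^+ 2 = c by rewrite expr2 mulrA ac qc.
have Nq : N * q = 0 by rewrite mulrBl -mulrA qq subrr.
have qN : q * N = q * a - a * q by rewrite mulrBr !(mulrA q) qaq.
have Na : N * a = N * N.
  by rewrite mulrBr (_ : N * (a * q) = 0) ?subr0// -qaq !(mulrA N) Nq !mul0r.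
have qN' : N - q * N = a - q * a.
  by rewrite qN /N opprB addrA subrK.
have Nn n : N ^+ n.+1 = N * a ^+ n by apply: expr_subr_corner.
clearbody c N.
have V0 : superexp_small (fun n => a ^+ n.+1 - q * a ^+ n.+1).
  have -> : (fun n => a ^+ n.+1 - q * a ^+ n.+1) =
            (fun n => (1 - q) * N ^+ n.+1 * 1).
    apply/funext => n; rewrite mulr1 Nn mulrA mulrBl mul1r qN' mulrBl -mulrA.
    by rewrite -exprS.
  exact/superexp_smallMlr/superexp_smallS.
pose u n := c ^+ n.+1 * N ^+ n.+1.
have u0 : superexp_small u.
  apply/(superexp_smallS (fun n => c ^+ n * N ^+ n)).
  exact: superexp_smallMX.
have /cvg_ex[s us] := superexp_small_cvg_series u0.
(* Left multiplication by [a] strips one [c] from each term: the first term becomes [q * N], and the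
   other [n] become the [n]-th partial sum times [N]. Hence the shifted partial sums. *)
have us1 : (series u n.+1) @[n --> \oo] --> s by rewrite cvg_shiftS.
have sq : s * q = 0.
  apply: (norm_cvg_unique (cvgMrr q us)) => //.
  rewrite (_ : (fun n => _) = fun=> 0); first exact: cvg_cst.
  apply/funext => n; rewrite /series/= mulr_suml big1// => k _.
  by rewrite /u [N ^+ _]exprSr -!mulrA Nq !mulr0.
have qs : q * s = s.
  apply: (norm_cvg_unique (cvgMrl q us)) => //.
  rewrite (_ : (fun n => _) = series u)//.
  apply/funext => n; rewrite /series/= mulr_sumr; apply: eq_bigr => k _.
  by rewrite /u exprS !(mulrA q) qc.
have sa : s * a = s * N.
  apply: (norm_cvg_unique (cvgMrr a us)) => //.
  rewrite (_ : (fun n => _) = fun n => series u n * N); first exact: cvgMrr.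
  apply/funext => n; rewrite /series/= !mulr_suml; apply: eq_bigr => k _.
  by rewrite /u [N ^+ _]exprSr -!mulrA Na.
have as_ : a * s = q * N + s * N.
  apply: (norm_cvg_unique (cvgMrl a us1)) => //.
  rewrite (_ : (fun n => _) = fun n => q * N + series u n * N).
    by apply: cvgD; [exact: cvg_cst | exact: cvgMrr].
  apply/funext => n; rewrite /series/= big_nat_recl// mulrDr mulr_sumr mulr_suml.
  congr (_ + _); first by rewrite /u !expr1 mulrA ac.
  apply: eq_bigr => k _; rewrite /u 2!exprS [N ^+ _]exprSr.
  by rewrite !mulrA ac qc.
pose p := q + s.
(* As [q * N = q * a - a * q] and [s * a = s * N], the Sylvester equation is exactly commutation. *)
have pa : p * a = a * p by rewrite /p mulrDl mulrDr as_ sa qN addrA subrKC.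
have qp : q * p = p by rewrite mulrDr qq qs.
have pq : p * q = q by rewrite mulrDl qq sq addr0.
clearbody p.
have pp : p * p = p by rewrite -{2}qp mulrA pq.
have acp : a * (c * p) = p by rewrite mulrA ac qp.
exists (c * p); split.
- split.
  + by rewrite expr2 mulrA acp -{1}qc !mulrA pq qc.
  + by rewrite acp expr2 -mulrA acp pa.
  + apply/root_norm_cvg0P/superexp_smallS; rewrite acp pa.
    (* From [p * q = q] one gets [(1 - p) * (1 - q) = 1 - p], which reduces quasinilpotency to
       [V0]. *)
    have -> : (fun n => (a - a * p) ^+ n.+1) =
              (fun n => (1 - p) * (a ^+ n.+1 - q * a ^+ n.+1) * 1).
      apply/funext => n; rewrite mulr1 expr_subr_corner; last first.
        by rewrite pa -mulrA pp.
      rewrite mulrBl -exprS -pa -mulrA -exprS mulrBl mul1r mulrBr mulrA pq.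
      by rewrite opprB addrA subrK.
    exact: superexp_smallMlr.
- by rewrite ac2.
- have sB : star (a ^+ m * q) * a ^+ m = star (a ^+ m) * (a ^+ m * q).
    by move: sab; rewrite -mulrA amb starM starK.
  (* This factorization puts [star (a ^+ m * q)] at the right end of [star p], where [sB] allows a
     factor [q] to be inserted after [a ^+ m]. *)
  have pB : a ^+ m * q * (c ^+ m * p) = p.
    case: (m) => [|k]; first by rewrite !expr0 !mul1r.
    rewrite -mulrA (mulrA q) [c ^+ _]exprS (mulrA q) qc -exprS mulrA.
    by rewrite exprSM_right_inverse// ac.
  rewrite acp exprSr -!mulrA ac -pB starM -!mulrA; congr (_ * _).
  by rewrite mulrA sB -!mulrA qq.
- apply/root_norm_cvg0P/superexp_smallS; rewrite ac.
  exact: V0.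
Qed.

End Equivalence.

Theorem theorem3p7 (R : realType) (A : banachStarAlgType R)
    (hproper : proper_involution A) (a : A) (m : nat) (hm : (1 <= m)%N) :
  (exists x : A, gen_right_group_inverse m a x) <->
  (exists b : A,
    [/\ b * a * b = b,
        a ^+ 2 * b ^+ 2 = a * b,
        star (star (a ^+ m) * a ^+ m.+1 * b) = star (a ^+ m) * a ^+ m.+1 * b,
        principal_right_ideal (a * b) = principal_right_ideal (a ^+ 2 * b) &
        qnil (a - a ^+ 2 * b)]).
Proof.
split=> [[x xP]|[b [bab a2b2 sab abA N0]]].
  exact: gen_right_group_inverse_outer xP.
by exists (a * b * b * (a * b)); exact: outer_gen_right_group_inverse.
Qed.
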